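(* Let $G_1$ be an $r_1$-regular graph with $n_1$ vertices and $m_1$ edges and let $G_2$ be an arbitrary graph with $n_2$ vertices. Then the Kirchhoff index of the central vertex corona $G_1\odot G_2$ is $$Kf(G_1\odot G_2)=(n_1+m_1+n_1n_2)\bigg[\frac{m_1-n_1}{2}+\frac{n_2+r_1+3}{r_1+2n_2+2}+\sum_{j=2}^{n_2}\frac{n_1}{1+\mu_j(G_2)}+\sum_{i=2}^{n_1}\frac{2n_2+3n_1+2\lambda_i(G_1)+2-r_1}{2n_1-r_1+\lambda_i(G_1)}\bigg].$$
   Context: All graphs are finite, simple and connected. For a graph $G$ on $n$ vertices, $A(G)$ is its adjacency matrix with eigenvalues $\lambda_1(G)\ge\dots\ge\lambda_n(G)$; $L(G)=D(G)-A(G)$ is the Laplacian matrix ($D(G)$ the diagonal matrix of vertex degrees) with eigenvalues $0=\mu_1(G)<\mu_2(G)\le\dots\le\mu_n(G)$. The Kirchhoff index of a connected graph $G$ is $Kf(G)=\sum_{i<j}r^*_{i,j}$, where $r^*_{i,j}$ is the resistance distance between vertices $v_i$ and $v_j$ (the effective resistance between them when every edge of $G$ is a unit resistor); it is known that $Kf(G)=n\sum_{i=2}^n\frac1{\mu_i(G)}$. The central graph $C(G)$ of $G$ is obtained from $G$ by subdividing each edge of $G$ exactly once and joining all pairs of distinct vertices of $G$ that are nonadjacent in $G$. The central vertex corona $G_1\odot G_2$ is obtained by taking one copy of $C(G_1)$ and $|V(G_1)|$ copies of $G_2$, and joining the vertex $v_i$ of $G_1$ (viewed in $C(G_1)$)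 to every vertex in the $i$-th copy of $G_2$, for each $i$. *)

(* Defs.v *)
From HB Require Import structures.
From mathcomp Require Import all_boot all_order all_algebra.
From mathcomp Require classical_sets.

Set Implicit Arguments.
Unset Strict Implicit.
Unset Printing Implicit Defensive.

Import Order.TTheory GRing.Theory Num.Theory.

Local Open Scope ring_scope.

Record sgraph := SGraph {
  vertex :> finType;
  adj : rel vertex;
  adj_sym : symmetric adj;
  adj_irrefl : irreflexive adj
}.

(* The graph with no vertices is not counted as connected. *)
Definition connected_graph (G : sgraph) : Prop :=
  (0 < #|G|)%N /\ forall x y : G, connect (@adj G) x y.

Definition degree (G : sgraph) (x : G) : nat := #|[set y | adj x y]|.

Definition regular (r : nat) (G : sgraph) : Prop :=
  forall x : G, degree x = r.

Definition edges (G : sgraph) : {set {set G}} :=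
  [set e | [exists x, exists y, adj x y && (e == [set x; y])]].

Section CentralGraph.
Variable G : sgraph.

(* inl x is an original vertex, inr e the vertex subdividing the edge e. *)
Definition central_vertex : finType := (G + {e : {set G} | e \in edges G})%type.

Definition central_adj (u v : central_vertex) : bool :=
  match u, v with
  | inl x, inl y => (x != y) && ~~ adj x y
  | inl x, inr e => x \in val e
  | inr e, inl x => x \in val e
  | inr _, inr _ => false
  end.

Lemma central_adj_sym : symmetric central_adj.
Proof. by case=> [x|e] [y|f] //=; rewrite eq_sym adj_sym. Qed.

Lemma central_adj_irrefl : irreflexive central_adj.
Proof. by case=> [x|e] //=; rewrite eqxx. Qed.

Definition central_graph : sgraph := SGraph central_adj_sym central_adj_irrefl.

End CentralGraph.

Section Corona.
Variables G1 G2 : sgraph.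

(* inr (i, x) is the vertex x of the i-th copy of G2. *)
Definition corona_vertex : finType := (central_graph G1 + G1 * G2)%type.

Definition corona_adj (u v : corona_vertex) : bool :=
  match u, v with
  | inl a, inl b => adj a b
  | inl a, inr p => a == inl p.1
  | inr p, inl a => a == inl p.1
  | inr p, inr q => (p.1 == q.1) && adj p.2 q.2
  end.

Lemma corona_adj_sym : symmetric corona_adj.
Proof.
by case=> [a|p] [b|q] //=; [apply: central_adj_sym | rewrite eq_sym adj_sym].
Qed.

Lemma corona_adj_irrefl : irreflexive corona_adj.
Proof.
by case=> [a|p] /=; [apply: central_adj_irrefl | rewrite adj_irrefl andbF].
Qed.

Definition central_vertex_corona : sgraph :=
  SGraph corona_adj_sym corona_adj_irrefl.

End Corona.

Section Spectra.
Variable R : rcfType.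

Definition adjacency_mx (G : sgraph) : 'M[R]_#|G| :=
  \matrix_(i, j) (adj (enum_val i) (enum_val j))%:R.

Definition degree_mx (G : sgraph) : 'M[R]_#|G| :=
  diag_mx (\row_i (degree (enum_val i))%:R).

Definition laplacian_mx (G : sgraph) : 'M[R]_#|G| :=
  degree_mx G - adjacency_mx G.

(* The eigenvalues with multiplicity, in unspecified order. The default [::] is
   reached only when the characteristic polynomial does not split over R, which
   never happens for a symmetric matrix. *)
Definition eigenvalues n (M : 'M[R]_n) : seq R :=
  classical_sets.xget [::]
    (fun s : seq R => char_poly M = \prod_(x <- s) ('X - x%:P)).

(* lambda_1 >= ... >= lambda_n and mu_1 <= ... <= mu_n, indexed from 1. *)
Definition adj_eigenvalue (G : sgraph) (i : nat) : R :=
  nth 0 (sort (fun x y => y <= x) (eigenvalues (adjacency_mx G))) i.-1.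

Definition lap_eigenvalue (G : sgraph) (i : nat) : R :=
  nth 0 (sort (fun x y => x <= y) (eigenvalues (laplacian_mx G))) i.-1.

End Spectra.

Section Resistance.
Variables (R : rcfType) (G : sgraph).

(* Every edge is a unit resistor, so by Ohm's law the current from x to a
   neighbour y is v x - v y; Kirchhoff's current law is imposed with one unit of
   current entering at a and leaving at b. *)
Definition unit_current_potential (a b : G) (v : G -> R) : Prop :=
  forall x : G, \sum_(y | adj x y) (v x - v y) = (x == a)%:R - (x == b)%:R.

Definition is_effective_resistance (a b : G) (r : R) : Prop :=
  exists2 v : G -> R, unit_current_potential a b v & r = v a - v b.

(* In a connected graph the effective resistance exists and is unique, so the
   default 0 is irrelevant. *)
Definition resistance_distance (a b : G) : R :=
  classical_sets.xget 0 (is_effective_resistance a b).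

Definition kirchhoff_index : R :=
  \sum_(a : G) \sum_(b : G | (enum_rank a < enum_rank b)%N)
    resistance_distance a b.

End Resistance.

(* Main.v *)
Require Import Defs.
From HB Require Import structures.
From mathcomp Require Import all_boot all_order all_algebra.
From mathcomp Require Import complex ring lra.

Set Implicit Arguments.
Unset Strict Implicit.
Unset Printing Implicit Defensive.

Import Order.TTheory GRing.Theory Num.Theory.

Local Open Scope ring_scope.

(** Write [L] for the Laplacian of a graph on [N] vertices. If a symmetric [X]
    satisfies [L X = I - c 1^T] for some column [c], then
    [x |-> X x a - X x b] is a unit current potential from [a] to [b], so the
    resistance distance is [X a a + X b b - 2 X a b] and the Kirchhoff index is
    [N tr X - 1^T X 1] ([kirchhoff_index_ginv]). No eigenvalue of the large
    graph is needed: it is enough to exhibit such an [X] for the corona.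

    Eliminating the subdivision vertices and the copies of [G2] leaves, on the
    vertices of [G1], the Schur complement [S = M - J] with
    [M = n1 I + (A(G1) - r1 I) / 2]. Since [M 1 = n1 1], the matrix
    [Q = M^-1] satisfies [S Q = I - J / n1]. Let [phi u] be the weights that
    extend a function on [G1] harmonically to the vertex [u] of the corona (half
    the sum over the two ends on a subdivision vertex, constant on each copy).
    Then
      [X u w = \sum_(x, y) phi u x * phi w y * Q x y + D u w],
    where [D] is [1/2 I] on the subdivision vertices, [(I + L(G2))^-1] on each
    copy and 0 elsewhere, has the required property
    ([laplacian_corona_green]). Its trace and total sum only involve [tr Q] and
    [tr (I + L(G2))^-1] ([trace_corona_green], [sum_corona_green]).

    These two traces are sums over spectra ([trace_resolvent]): a real symmetric
    matrix is diagonalizable over [R[i]] with real diagonal. Gershgorin's bound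
    gives [|lambda| <= r1] and [0 <= mu], hence the resolvents exist and the
    denominators are nonzero. The constant vector shows that both bounds are
    attained, so the eigenvalues left out of the sums in the theorem are
    [lambda_1 = r1] and [mu_1 = 0]. *)

(** * Spectra of real symmetric matrices *)

Section SymmetricSpectrum.
Variable R : rcfType.
Local Notation toC := (real_complex R).

Lemma char_poly_similar (F : fieldType) n (P D : 'M[F]_n) :
  P \in unitmx -> char_poly (invmx P *m D *m P) = char_poly D.
Proof.
move=> uP.
have eqM : char_poly_mx (invmx P *m D *m P)
    = map_mx polyC (invmx P) *m char_poly_mx D *m map_mx polyC P.
  rewrite /char_poly_mx mulmxBr mulmxBl -!map_mxM scalar_mxC.
  rewrite -[_%:M *m _ *m _]mulmxA.
  by rewrite -map_mxM mulVmx // map_mx1 mulmx1.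
rewrite /char_poly eqM !det_mulmx mulrAC -det_mulmx -map_mxM mulVmx //.
by rewrite map_mx1 det1 mul1r.
Qed.

(** The matrix [P] is complex, but the diagonal [d] is real; the last clause
    makes [char_poly A] split over [R]. *)
Lemma symmetric_diagonalization n (A : 'M[R]_n) : A^T = A ->
  exists P : 'M[R[i]]_n, exists d : 'rV[R]_n, [/\ P \in unitmx,
      map_mx toC A = invmx P *m diag_mx (map_mx toC d) *m P
    & char_poly A = \prod_(x <- [seq d 0 i | i : 'I_n]) ('X - x%:P)].
Proof.
move=> symA; set B := map_mx toC A.
have hB : B \is hermsymmx.
  apply: realsym_hermsym.
    by apply/is_hermitianmxP;
       rewrite expr0 scale1r /B map_mx_id // map_trmx symA.
  by apply/mxOverP=> i j; rewrite mxE complex_real.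
have /mxOverP rd := hermitian_spectral_diag_real hB.
pose P := spectralmx B; pose d := map_mx (@complex.Re R) (spectral_diag B).
have uP : P \in unitmx by apply: spectral_unit.
have defB : B = invmx P *m diag_mx (map_mx toC d) *m P.
  rewrite -map_mx_comp (_ : map_mx _ _ = spectral_diag B).
    by have /orthomx_spectralP := hermitian_normalmx hB.
  by apply/rowP=> i; rewrite mxE /= RRe_real.
exists P, d; split=> //.
apply: (map_poly_inj toC); rewrite map_char_poly -/B defB char_poly_similar //.
rewrite char_poly_trig; last exact/is_diag_mx_is_trig/diag_mx_is_diag.
rewrite big_image rmorph_prod /=; apply: eq_bigr => i _.
by rewrite !mxE eqxx rmorphB /= map_polyX map_polyC.
Qed.

Lemma char_poly_eigenvalues n (A : 'M[R]_n) : A^T = A ->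
  char_poly A = \prod_(x <- eigenvalues A) ('X - x%:P).
Proof.
move=> symA.
pose splits (s : seq R) := char_poly A = \prod_(x <- s) ('X - x%:P).
apply: (@classical_sets.xgetPex _ [::] splits).
have [P [d [_ _ chiA]]] := symmetric_diagonalization symA.
by exists [seq d 0 i | i : 'I_n].
Qed.

Lemma eigenvalue_mem n (A : 'M[R]_n) (a : R) : A^T = A ->
  (a \in eigenvalues A) = eigenvalue A a.
Proof.
move=> symA.
by rewrite eigenvalue_root_char char_poly_eigenvalues // root_prod_XsubC.
Qed.

Lemma size_eigenvalues n (A : 'M[R]_n) : A^T = A -> size (eigenvalues A) = n.
Proof.
move=> symA; apply: succn_inj.
by rewrite -(size_char_poly A) char_poly_eigenvalues // size_prod_XsubC.
Qed.

(** Any right inverse [Q] of [c I + A] will do: it is then diagonalized in the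
    same basis as [A]. *)
Lemma trace_resolvent n (A Q : 'M[R]_n) (c : R) : A^T = A ->
  (c%:M + A) *m Q = 1%:M -> \tr Q = \sum_(x <- eigenvalues A) (c + x)^-1.
Proof.
move=> symA defQ.
have [P [d [uP defA chiA]]] := symmetric_diagonalization symA.
have eigA : perm_eq (eigenvalues A) [seq d 0 i | i : 'I_n].
  by apply: prod_XsubC_eq; rewrite -char_poly_eigenvalues.
rewrite (perm_big _ eigA) big_image /=.
have defcA : map_mx toC (c%:M + A)
    = invmx P *m diag_mx (map_mx toC (const_mx c + d)) *m P.
  rewrite map_mxD defA !raddfD /= map_const_mx diag_const_mx mulmxDl.
  rewrite map_scalar_mx.
  by rewrite scalar_mxC -[_%:M *m _ *m _]mulmxA mulVmx // mulmx1.
have /(congr1 (fun M => P *m M *m invmx P)) := congr1 (map_mx toC) defQ.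
rewrite map_mxM defcA map_mx1 mulmx1 mulmxV // !mulmxA mulmxV // mul1mx.
rewrite -!mulmxA mul_diag_mx => /matrixP dQ; apply: (@complexI R).
rewrite -[LHS]/(toC (\tr Q)) -(trace_map_mx toC).
have -> : \tr (map_mx toC Q) = \tr (P *m (map_mx toC Q *m invmx P)).
  by rewrite mulmxA mxtrace_mulC mulmxA mulVmx // mul1mx.
rewrite [RHS]rmorph_sum /mxtrace; apply: eq_bigr => i _.
have := dQ i i; rewrite !mxE eqxx /= => e.
have nz : toC (c + d 0 i) != 0.
  by apply: contra_eq_neq e => ->; rewrite mul0r eq_sym oner_eq0.
by rewrite fmorphV; apply: (mulfI nz); rewrite e mulfV.
Qed.

Lemma resolvent_unit n (A : 'M[R]_n) (c : R) :
  (forall a, eigenvalue A a -> c + a != 0) -> c%:M + A \in unitmx.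
Proof.
move=> nz; rewrite -row_free_unit -kermx_eq0; apply/negPn/negP => ker0.
have /nz : eigenvalue A (- c).
  by rewrite /eigenvalue /eigenspace raddfN /= opprK addrC.
by rewrite subrr eqxx.
Qed.

(** Gershgorin's theorem, with column sums since eigenvectors are rows. *)
Lemma gershgorin n (A : 'M[R]_n) (a : R) : eigenvalue A a ->
  exists i, `|a - A i i| <= \sum_(j | j != i) `|A j i|.
Proof.
case/eigenvalueP=> v vA nzv.
have [i0 _ | vz] := pickP 'I_n; last first.
  by case/eqP: nzv; apply/rowP=> i; have := vz i.
(* The disc is the one of a coordinate of largest modulus of the eigenvector. *)
pose i := [arg max_(i > i0) `|v 0 i|]%O.
have maxi j : `|v 0 j| <= `|v 0 i|.
  by rewrite /i; case: arg_maxP => // k _ /(_ j); apply.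
have vi : 0 < `|v 0 i|.
  rewrite lt_def normr_ge0 andbT; apply: contra nzv => /eqP v0.
  by apply/eqP/rowP=> j; rewrite mxE; apply/eqP; rewrite -normr_le0 -v0.
exists i; rewrite -(ler_pM2r vi) -normrM mulrBl.
have /rowP/(_ i) := vA; rewrite !mxE (bigD1 i) //= => e.
have -> : a * v 0 i - A i i * v 0 i = \sum_(j | j != i) v 0 j * A j i.
  by rewrite -e [_ * A i i]mulrC addrC addrK.
rewrite mulr_suml.
apply: le_trans (ler_norm_sum _ _ _) _; apply: ler_sum => j _.
by rewrite normrM mulrC ler_wpM2l.
Qed.

End SymmetricSpectrum.

(** * Matrices indexed by a finite type *)

Lemma sum_const (R : pzSemiRingType) (T : finType) (a : R) :
  \sum_(x : T) a = #|T|%:R * a.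
Proof. by rewrite sumr_const mulr_natl. Qed.

Section KernelMatrix.
Variables (R : rcfType) (G : finType).
Implicit Types (k Q : G -> G -> R) (c s : R).

Lemma sum_enum_val (P : pred G) (f : G -> R) :
  \sum_(x | P x) f x = \sum_(i < #|G| | P (enum_val i)) f (enum_val i).
Proof.
rewrite (reindex (@enum_val G xpredT)) //.
by exists enum_rank => x _; rewrite ?enum_valK ?enum_rankK.
Qed.

(** The square matrix of a function of two arguments, with rows and columns
    numbered by [enum_val] as in [adjacency_mx] and [laplacian_mx]. *)
Definition kernel_mx k : 'M[R]_#|G| :=
  \matrix_(i, j) k (enum_val i) (enum_val j).

Lemma kernel_mx_sym k :
  (forall x y, k x y = k y x) -> (kernel_mx k)^T = kernel_mx k.
Proof. by move=> symk; apply/matrixP=> i j; rewrite !mxE. Qed.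

Lemma kernel_gershgorin k (a : R) : eigenvalue (kernel_mx k) a ->
  exists x, `|a - k x x| <= \sum_(y | y != x) `|k y x|.
Proof.
case/gershgorin=> i; rewrite mxE => le_a; exists (enum_val i).
apply: le_trans le_a _; rewrite [leRHS]sum_enum_val.
rewrite le_eqVlt; apply/orP; left; apply/eqP; apply: eq_big => [j|j _].
  by rewrite (inj_eq enum_val_inj).
by rewrite mxE.
Qed.

Lemma kernel_eigenvalue_rowsum k s : (0 < #|G|)%N ->
  (forall x, \sum_y k y x = s) -> eigenvalue (kernel_mx k) s.
Proof.
move=> G_gt0 rs; apply/eigenvalueP; exists (const_mx 1).
  apply/rowP=> i; rewrite !mxE mulr1 -(rs (enum_val i)).
  rewrite [RHS]sum_enum_val.
  by apply: eq_bigr => j _; rewrite !mxE mul1r.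
by apply/eqP=> /rowP/(_ (Ordinal G_gt0))/eqP; rewrite !mxE oner_eq0.
Qed.

(** The inverse [Q] of [c I + k], as a function on [G]. *)
Lemma kernel_green k c : (forall x y, k x y = k y x) ->
    (forall a, eigenvalue (kernel_mx k) a -> c + a != 0) ->
  exists Q, [/\ forall x y, Q x y = Q y x,
    forall x z, c * Q x z + \sum_y k x y * Q y z = (x == z)%:R
  & \sum_x Q x x = \sum_(a <- eigenvalues (kernel_mx k)) (c + a)^-1].
Proof.
move=> symk /resolvent_unit; set K := kernel_mx k => uK.
have symK : K^T = K by apply: kernel_mx_sym.
pose P := invmx (c%:M + K); exists (fun x y => P (enum_rank x) (enum_rank y)).
have KP : (c%:M + K) *m P = 1%:M by rewrite mulmxV.
have symP : P^T = P by rewrite /P trmx_inv raddfD /= tr_scalar_mx symK.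
split=> [x y|x z|]; first by rewrite -{1}symP mxE.
  move/matrixP/(_ (enum_rank x) (enum_rank z)): KP.
  rewrite mulmxDl mul_scalar_mx !mxE (inj_eq enum_rank_inj) => <-.
  congr (_ + _).
  rewrite sum_enum_val.
  by apply: eq_bigr => j _; rewrite !mxE enum_rankK enum_valK.
rewrite -(trace_resolvent symK KP) sum_enum_val.
by apply: eq_bigr => j _; rewrite enum_valK.
Qed.

Lemma green_rowsum k Q c s : (forall x y, k x y = k y x) ->
    (forall x y, Q x y = Q y x) ->
    (forall x z, c * Q x z + \sum_y k x y * Q y z = (x == z)%:R) ->
    (forall x, \sum_y k x y = s) ->
  forall x, (c + s) * \sum_z Q x z = 1.
Proof.
move=> symk symQ eqQ rs x.
have <- : \sum_z (z == x)%:R = 1 :> R.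
  by rewrite (bigD1 x) //= eqxx big1 ?addr0 // => z /negbTE->.
under [RHS]eq_bigr do rewrite -eqQ.
rewrite big_split exchange_big /= mulrDl !mulr_sumr.
congr (_ + _); apply: eq_bigr => z _.
  by rewrite symQ.
rewrite -mulr_suml symQ; congr (_ * _).
by rewrite -(rs z); apply: eq_bigr => y _.
Qed.

End KernelMatrix.

(** * Adjacency and Laplacian spectra of a graph *)

Section GraphSpectrum.
Variables (R : rcfType) (G : sgraph).

(** The entries of the adjacency and Laplacian matrices, as functions on [G]. *)
Definition adjacency_kernel (x y : G) : R := (adj x y)%:R.

Definition laplacian_kernel (x y : G) : R :=
  (degree x)%:R *+ (x == y) - (adj x y)%:R.

Lemma adjacency_mxE : adjacency_mx R G = kernel_mx adjacency_kernel.
Proof. by []. Qed.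

Lemma laplacian_mxE : laplacian_mx R G = kernel_mx laplacian_kernel.
Proof.
by apply/matrixP=> i j; rewrite !mxE /laplacian_kernel (inj_eq enum_val_inj).
Qed.

Lemma adjacency_kernel_sym x y : adjacency_kernel x y = adjacency_kernel y x.
Proof. by rewrite /adjacency_kernel adj_sym. Qed.

Lemma laplacian_kernel_sym x y : laplacian_kernel x y = laplacian_kernel y x.
Proof.
rewrite /laplacian_kernel adj_sym eq_sym.
by case: (y =P x) => [->|]; rewrite ?mulr0n.
Qed.

Lemma adj_sumE (x : G) (f : G -> R) :
  \sum_(y | adj x y) f y = \sum_y adjacency_kernel x y * f y.
Proof.
by rewrite big_mkcond; apply: eq_bigr => y _; rewrite /adjacency_kernel;
  case: (adj x y); rewrite ?mul1r ?mul0r.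
Qed.

Lemma sum_adj_const (x : G) (a : R) : \sum_(y | adj x y) a = (degree x)%:R * a.
Proof. by rewrite sumr_const /degree cardsE mulr_natl. Qed.

(** The Laplacian matrix acts on functions as the net outgoing current. *)
Lemma laplacian_kernelE (x : G) (f : G -> R) :
  \sum_y laplacian_kernel x y * f y = \sum_(y | adj x y) (f x - f y).
Proof.
rewrite sumrB sum_adj_const adj_sumE /laplacian_kernel.
under eq_bigr do rewrite mulrBl.
rewrite sumrB (bigD1 x) //= eqxx big1 ?addr0 // => y.
by rewrite eq_sym => /negbTE->; rewrite mul0r.
Qed.

Lemma adjacency_rowsum x : \sum_y adjacency_kernel x y = (degree x)%:R.
Proof.
under eq_bigr do rewrite -[adjacency_kernel _ _]mulr1.
by rewrite -adj_sumE sum_adj_const mulr1.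
Qed.

Lemma laplacian_rowsum x : \sum_y laplacian_kernel x y = 0.
Proof.
under eq_bigr do rewrite -[laplacian_kernel _ _]mulr1.
by rewrite laplacian_kernelE big1 // => y _; rewrite subrr.
Qed.

Lemma sum_adjacency_offdiag x :
  \sum_(y | y != x) `|adjacency_kernel y x| = (degree x)%:R.
Proof.
rewrite -adjacency_rowsum [RHS](bigD1 x) //= {2}/adjacency_kernel.
rewrite adj_irrefl add0r.
by apply: eq_bigr => y _; rewrite adjacency_kernel_sym ger0_norm // ler0n.
Qed.

Lemma adj_eigenvalue_le r a : regular r G ->
  eigenvalue (adjacency_mx R G) a -> `|a| <= r%:R.
Proof.
rewrite adjacency_mxE => reg /kernel_gershgorin[x].
rewrite sum_adjacency_offdiag reg.
by rewrite /adjacency_kernel adj_irrefl subr0.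
Qed.

Lemma lap_eigenvalue_ge0 a : eigenvalue (laplacian_mx R G) a -> 0 <= a.
Proof.
rewrite laplacian_mxE => /kernel_gershgorin[x].
rewrite (_ : \sum_(_ | _) _ = (degree x)%:R); last first.
  rewrite -sum_adjacency_offdiag; apply: eq_bigr => y /negbTE nyx.
  by rewrite /laplacian_kernel nyx sub0r normrN.
rewrite /laplacian_kernel eqxx adj_irrefl subr0 mulr1n ler_distl => /andP[].
by rewrite subrr.
Qed.

(** Dropping the first entry of a sorted list removes one copy of its least
    element [m]; the indices are shifted because eigenvalues are numbered
    from 1. *)
Lemma sum_sorted_behead (le : rel R) (s : seq R) (F : R -> R) (m : R) :
    total le -> transitive le -> antisymmetric le -> m \in s ->
    (forall x, x \in s -> le m x) ->
  \sum_(2 <= i < (size s).+1) F (nth 0 (sort le s) i.-1) =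
  \sum_(x <- s) F x - F m.
Proof.
move=> le_total le_trans le_anti ms minm.
have ps : perm_eq s (sort le s) by rewrite perm_sym perm_sort.
rewrite [in RHS](perm_big _ ps) -(size_sort le s) /=.
have := sort_sorted le_total s.
have : m \in sort le s by rewrite mem_sort.
have : forall x, x \in sort le s -> le m x.
  by move=> x; rewrite mem_sort => /minm.
case: (sort le s) => // x t minm' mxt sxt.
have /= le_xm := order_path_min le_trans sxt.
have -> : m = x.
  apply: le_anti; rewrite minm' ?mem_head //=.
  move: mxt; rewrite inE => /predU1P[<-|/(allP le_xm)//].
  by have := le_total m m; rewrite orbb.
rewrite big_cons addrAC subrr add0r big_add1 /= big_add1 /= [RHS](big_nth 0).
by rewrite !big_mkord; apply: eq_bigr.
Qed.

Lemma sum_adj_eigenvalue r (F : R -> R) : (0 < #|G|)%N -> regular r G ->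
  \sum_(2 <= i < #|G|.+1) F (adj_eigenvalue R G i) =
  \sum_(x <- eigenvalues (adjacency_mx R G)) F x - F r%:R.
Proof.
move=> G_gt0 reg; have symA := kernel_mx_sym adjacency_kernel_sym.
rewrite -adjacency_mxE in symA.
have rA : eigenvalue (adjacency_mx R G) r%:R.
  rewrite adjacency_mxE; apply: kernel_eigenvalue_rowsum => // x.
  by under eq_bigr do rewrite adjacency_kernel_sym; rewrite adjacency_rowsum reg.
(* The list is sorted for [>=], so its least element is the largest value. *)
rewrite -{1}(size_eigenvalues symA); apply: sum_sorted_behead.
- by move=> x y; rewrite le_total.
- by move=> x y z /= yx zy; apply: le_trans yx.
- by move=> x y; rewrite andbC => /le_anti.
- by rewrite eigenvalue_mem.
move=> x; rewrite eigenvalue_mem // => /(adj_eigenvalue_le reg).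
exact/le_trans/ler_norm.
Qed.

Lemma sum_lap_eigenvalue (F : R -> R) : (0 < #|G|)%N ->
  \sum_(2 <= i < #|G|.+1) F (lap_eigenvalue R G i) =
  \sum_(x <- eigenvalues (laplacian_mx R G)) F x - F 0.
Proof.
move=> G_gt0; have symL := kernel_mx_sym laplacian_kernel_sym.
rewrite -laplacian_mxE in symL.
have L0 : eigenvalue (laplacian_mx R G) 0.
  rewrite laplacian_mxE; apply: kernel_eigenvalue_rowsum => // x.
  by under eq_bigr do rewrite laplacian_kernel_sym; rewrite laplacian_rowsum.
rewrite -{1}(size_eigenvalues symL); apply: sum_sorted_behead.
- exact: le_total.
- exact: le_trans.
- exact: le_anti.
- by rewrite eigenvalue_mem.
by move=> x; rewrite eigenvalue_mem // => /lap_eigenvalue_ge0.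
Qed.

End GraphSpectrum.

(** * Resistance distances from a generalized inverse of the Laplacian *)

Section GeneralizedInverse.
Variables (R : rcfType) (G : sgraph).

Lemma graph_laplacian_selfadjoint (v w : G -> R) :
  \sum_x w x * (\sum_(y | adj x y) (v x - v y)) =
  \sum_x v x * (\sum_(y | adj x y) (w x - w y)).
Proof.
under eq_bigr do rewrite -laplacian_kernelE mulr_sumr.
under [RHS]eq_bigr do rewrite -laplacian_kernelE mulr_sumr.
rewrite exchange_big; apply: eq_bigr => x _; apply: eq_bigr => y _.
by rewrite laplacian_kernel_sym; ring.
Qed.

Lemma sum_delta_diff (w : G -> R) a b :
  \sum_x w x * ((x == a)%:R - (x == b)%:R) = w a - w b.
Proof.
have D c : \sum_x w x * (x == c)%:R = w c.
  rewrite (bigD1 c) //= eqxx mulr1 big1 ?addr0 // => x /negbTE->.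
  by rewrite mulr0.
by under eq_bigr do rewrite mulrBr; rewrite sumrB !D.
Qed.

(** The voltage drop of each of two unit current potentials from [a] to [b]
    is its pairing with the Laplacian of the other, so the two drops agree by
    self-adjointness; connectedness plays no role. *)
Lemma effective_resistance_unique a b (r s : R) :
  @is_effective_resistance R G a b r -> @is_effective_resistance R G a b s ->
  r = s.
Proof.
move=> [v Lv ->] [w Lw ->]; rewrite -2!sum_delta_diff.
under eq_bigr do rewrite -Lw.
by under [RHS]eq_bigr do rewrite -Lv; apply: graph_laplacian_selfadjoint.
Qed.

Variables (X : G -> G -> R) (c : G -> R).
Hypothesis symX : forall x y, X x y = X y x.
(* [L X = I - c 1^T] *)
Hypothesis LX : forall x z,
  \sum_(y | adj x y) (X x z - X y z) = (x == z)%:R - c x.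

Lemma resistance_distance_ginv a b :
  resistance_distance R a b = X a a + X b b - 2 * X a b.
Proof.
have res_ab : is_effective_resistance a b (X a a + X b b - 2 * X a b).
  exists (fun x => X x a - X x b); last by rewrite (symX b a); ring.
  move=> x; transitivity (\sum_(y | adj x y) (X x a - X y a)
                        - \sum_(y | adj x y) (X x b - X y b)).
    by rewrite -sumrB; apply: eq_bigr => y _; ring.
  by rewrite !LX; ring.
apply: classical_sets.xget_unique => // s res_s.
exact: effective_resistance_unique res_s res_ab.
Qed.

(** [r a b] is symmetric and vanishes on the diagonal, so the sum over all
    ordered pairs is twice the Kirchhoff index. *)
Lemma kirchhoff_index_ginv :
  kirchhoff_index R G = #|G|%:R * \sum_a X a a - \sum_a \sum_b X a b.
Proof.
pose r a b : R := X a a + X b b - 2 * X a b.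
have rC a b : r a b = r b a by rewrite /r (symX b a); ring.
have rr a : r a a = 0 by rewrite /r; ring.
have total : \sum_a \sum_b r a b =
    2 * (#|G|%:R * \sum_a X a a - \sum_a \sum_b X a b).
  rewrite /r; under eq_bigr do rewrite sumrB big_split /= sumr_const -mulr_sumr.
  rewrite sumrB big_split /= sumr_const -mulr_sumr sumrMnl cardT -cardE.
  by rewrite -[_ *+ _]mulr_natl; ring.
have half : \sum_a \sum_b r a b = 2 * kirchhoff_index R G.
  rewrite /kirchhoff_index.
  under [X in 2 * X]eq_bigr do
    under eq_bigr do rewrite resistance_distance_ginv -/(r _ _).
  transitivity (\sum_a (\sum_(b | (enum_rank a < enum_rank b)%N) r a b
                + \sum_(b | (enum_rank b < enum_rank a)%N) r a b)).
    apply: eq_bigr => a _.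
    rewrite (bigID (fun b => enum_rank a < enum_rank b)%N) /=.
    congr (_ + _); rewrite (bigD1 a) /= ?ltnn // rr add0r; apply: eq_bigl => b.
    by rewrite -leqNgt ltn_neqAle andbC (inj_eq val_inj) (inj_eq enum_rank_inj).
  rewrite big_split mulr2n mulrDl mul1r /=; congr (_ + _).
  under eq_bigr do rewrite big_mkcond.
  rewrite exchange_big; apply: eq_bigr => a _; rewrite [RHS]big_mkcond.
  by apply: eq_bigr => b _; rewrite rC.
by apply: (@mulfI _ 2); rewrite ?pnatr_eq0 // -half total.
Qed.

End GeneralizedInverse.

(** * Sums over the edges of a graph *)

Lemma degree_lt_card (G : sgraph) (x : G) : (degree x < #|G|)%N.
Proof.
rewrite -cardsT proper_card // properT; apply/eqP=> /setP/(_ x).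
by rewrite !inE adj_irrefl.
Qed.

Section EdgeSums.
Variables (R : rcfType) (G : sgraph).
Local Notation E := {e : {set G} | e \in edges G}.

Lemma card_edge (e : E) : #|val e| = 2%N.
Proof.
case: e => e /=; rewrite inE => /existsP[x /existsP[y /andP[xy /eqP->]]].
by rewrite cards2; case: eqP xy => // ->; rewrite adj_irrefl.
Qed.

(** The edges containing [x] correspond to the neighbours of [x]. *)
Lemma sum_incident (x : G) (F : {set G} -> R) :
  \sum_(e : E | x \in val e) F (val e) = \sum_(y | adj x y) F [set x; y].
Proof.
have -> : \sum_(e : E | x \in val e) F (val e)
        = \sum_(e in edges G | x \in e) F e.
  rewrite [RHS](reindex_omap (val : E -> {set G}) insub) /=; last first.
    by move=> e /andP[eG _]; rewrite insubT.
  by apply: eq_bigl => e; rewrite (valP e) valK eqxx andbT.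
have memN z y : (y \in adj z) = adj z y by [].
rewrite -(big_imset (h := fun y => [set x; y]) F) /=; last first.
  move=> y z xy _ /setP/(_ y); rewrite !inE eqxx orbT.
  by case: (y =P x) xy => [->|_ _ /esym/eqP//]; rewrite memN adj_irrefl.
apply: eq_bigl => e; apply/andP/imsetP => [[]|[y]]; last first.
  rewrite memN => xy ->; rewrite !inE eqxx; split=> //.
  by apply/existsP; exists x; apply/existsP; exists y; rewrite xy eqxx.
rewrite inE => /existsP[y /existsP[z /andP[yz /eqP->]]].
rewrite !inE => /orP[]/eqP->; first by exists z; rewrite ?memN.
by exists y; [rewrite memN adj_sym | rewrite setUC].
Qed.

Lemma sum_edge_vertex (g : E -> G -> R) :
  \sum_(e : E) \sum_(x in val e) g e x =
  \sum_x \sum_(e : E | x \in val e) g e x.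
Proof. by rewrite (exchange_big_dep xpredT). Qed.

Lemma sum_edge_ends (f : G -> R) :
  \sum_(e : E) \sum_(x in val e) f x = \sum_x (degree x)%:R * f x.
Proof.
rewrite sum_edge_vertex; apply: eq_bigr => x _.
by rewrite (sum_incident x (fun=> f x)) sum_adj_const.
Qed.

Lemma card_edge_type : #|{: E}| = #|edges G|.
Proof. by rewrite card_sig; apply: eq_card. Qed.

Lemma handshake : \sum_(x : G) (degree x)%:R = 2 * #|edges G|%:R :> R.
Proof.
under eq_bigr do rewrite -[_%:R]mulr1.
rewrite -(sum_edge_ends (fun=> 1)).
under eq_bigr do rewrite sumr_const card_edge.
by rewrite sumr_const card_edge_type mulr_natr.
Qed.

End EdgeSums.

(** * A generalized inverse of the Laplacian of the corona *)

Section CoronaGreen.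
Variables (R : rcfType) (G1 G2 : sgraph).
Local Notation C := (central_vertex_corona G1 G2).
Local Notation E := {e : {set G1} | e \in edges G1}.

(** The three kinds of vertices of the corona: those of [G1], those subdividing
    its edges, and those of the copies of [G2]. *)
Definition old_vertex (x : G1) : C := inl (inl x).
Definition edge_vertex (e : E) : C := inl (inr e).
Definition copy_vertex (p : G1 * G2) : C := inr p.

Lemma sum_corona (P : pred C) (F : C -> R) :
  \sum_(u | P u) F u = \sum_(x | P (old_vertex x)) F (old_vertex x)
    + \sum_(e | P (edge_vertex e)) F (edge_vertex e)
    + \sum_(p | P (copy_vertex p)) F (copy_vertex p).
Proof. by rewrite big_sumType; congr (_ + _); rewrite big_sumType. Qed.

Lemma sum_fibre (i : G1) (P : pred G2) (F : G1 * G2 -> R) :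
  \sum_(p | (i == p.1) && P p.2) F p = \sum_(y | P y) F (i, y).
Proof.
transitivity (\sum_(j | i == j) \sum_(y | P y) F (j, y)).
  by rewrite pair_big; apply: eq_bigr => -[].
by rewrite (big_pred1 i) // => j; apply: eq_sym.
Qed.

(** The coefficients of the harmonic extension to the corona of a function on
    [G1]. *)
Definition weight (u : C) (z : G1) : R :=
  match u with
  | inl (inl x) => (z == x)%:R
  | inl (inr e) => (z \in val e)%:R / 2
  | inr p => (z == p.1)%:R
  end.

(** The extension of [f] that is harmonic outside [G1]: the mean of the two end
    values on a subdivision vertex, and [f i] on the whole copy number [i]. *)
Definition extend (f : G1 -> R) (u : C) : R := \sum_z weight u z * f z.

Lemma extend_old f x : extend f (old_vertex x) = f x.
Proof.
rewrite /extend (bigD1 x) //= eqxx mul1r big1 ?addr0 // => z /negbTE->.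
by rewrite mul0r.
Qed.

Lemma extend_copy f p : extend f (copy_vertex p) = f p.1.
Proof.
rewrite /extend (bigD1 p.1) //= eqxx mul1r big1 ?addr0 // => z /negbTE->.
by rewrite mul0r.
Qed.

Lemma extend_edge f e : extend f (edge_vertex e) = (\sum_(z in val e) f z) / 2.
Proof.
rewrite /extend [in RHS]big_mkcond mulr_suml; apply: eq_bigr => z _ /=.
by case: (z \in val e); rewrite ?mul0r // mul1r mulrC.
Qed.

Lemma extend_const a u : extend (fun=> a) u = a.
Proof.
case: u => [[x|e]|p]; rewrite ?extend_old ?extend_copy //.
rewrite extend_edge sumr_const card_edge -[a *+ 2]mulr_natr.
by rewrite mulfK // pnatr_eq0.
Qed.

Lemma extend_delta x u : extend (fun z => (z == x)%:R) u = weight u x.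
Proof.
rewrite /extend (bigD1 x) //= eqxx mulr1 big1 ?addr0 // => z /negbTE->.
by rewrite mulr0.
Qed.

(** On the vertices of [G1] the Laplacian of the extension is the Schur
    complement [n1 I - J - L(G1) / 2], which is the same as
    [n1 I - J + (A(G1) - r I) / 2] when [G1] is [r]-regular. *)
Lemma laplacian_extend f (u : C) :
  \sum_(v | adj u v) (extend f u - extend f v) =
  if u is inl (inl x) then
    #|G1|%:R * f x - \sum_y f y - (\sum_(y | adj x y) (f x - f y)) / 2
  else 0.
Proof.
rewrite sum_corona; case: u => [[x|e]|[i x]] /=.
- rewrite [X in _ + X]big1 ?addr0; last first.
    by move=> p /eqP[xp]; rewrite extend_old extend_copy -xp subrr.
  under eq_bigr do rewrite !extend_old.
  under [X in _ + X]eq_bigr do rewrite extend_old extend_edge.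
  rewrite (sum_incident x (fun e : {set G1} => f x - (\sum_(z in e) f z) / 2)).
  have -> : \sum_(y | adj x y) (f x - (\sum_(z in [set x; y]) f z) / 2)
          = (\sum_(y | adj x y) (f x - f y)) / 2.
    rewrite mulr_suml; apply: eq_bigr => y xy.
    rewrite big_setU1 ?inE /=; last first.
      by apply: contraTneq xy => ->; rewrite adj_irrefl.
    by rewrite big_set1; field.
  have -> : #|G1|%:R * f x - \sum_y f y = \sum_y (f x - f y).
    by rewrite sumrB sum_const.
  have -> : \sum_y (f x - f y) = \sum_(y | adj x y) (f x - f y)
      + \sum_(y | (x != y) && ~~ adj x y) (f x - f y).
    rewrite (bigID (adj x)) /=; congr (_ + _).
    rewrite (bigD1 x) ?adj_irrefl //= subrr add0r; apply: eq_bigl => y.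
    by rewrite andbC eq_sym.
  by field.
- rewrite [X in _ + X + _]big_pred0 // [X in _ + X]big_pred0 // !addr0.
  under eq_bigr do rewrite extend_edge extend_old.
  rewrite sumrB sumr_const card_edge -[_ / 2 *+ 2]mulr_natr.
  by rewrite mulfVK ?subrr // pnatr_eq0.
rewrite [X in _ + X + _]big_pred0 // addr0 !big1 ?addr0 // => [[j y]|y] /=.
  by case/andP=> /eqP-> _; rewrite !extend_copy subrr.
by case/eqP=> ->; rewrite extend_copy extend_old subrr.
Qed.

Variables (Q : G1 -> G1 -> R) (H : G2 -> G2 -> R).

(** The inverse of the block of the corona Laplacian indexed by the vertices
    outside [G1]: such a vertex subdividing an edge has degree 2, and a copy of
    [G2] carries [I + L(G2)], of inverse [H]. *)
Definition local_green (u w : C) : R :=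
  match u, w with
  | inl (inr e), inl (inr f) => (e == f)%:R / 2
  | inr p, inr q => (p.1 == q.1)%:R * H p.2 q.2
  | _, _ => 0
  end.

(** The generalized inverse: [Q], the inverse of [n1 I - L(G1) / 2], extended
    harmonically in both arguments, plus the local part. *)
Definition corona_green (u w : C) : R :=
  extend (fun x => extend (Q x) w) u + local_green u w.

Hypothesis symQ : forall x y, Q x y = Q y x.
Hypothesis symH : forall x y, H x y = H y x.
(* [(n1 I - L(G1) / 2) Q = I] and [(I + L(G2)) H = I], with the row sums that
   follow from them. *)
Hypothesis lapQ : forall x z,
  \sum_(y | adj x y) (Q x z - Q y z) = 2 * (#|G1|%:R * Q x z - (x == z)%:R).
Hypothesis lapH : forall x z,
  \sum_(y | adj x y) (H x z - H y z) = (x == z)%:R - H x z.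
Hypothesis sumQ : forall x, \sum_y Q x y = #|G1|%:R^-1.
Hypothesis sumH : forall x, \sum_y H x y = 1.

Lemma corona_green_sym u w : corona_green u w = corona_green w u.
Proof.
rewrite /corona_green; congr (_ + _); last first.
  case: u w => [[x|e]|[i x]] [[y|f]|[j y]] //=; first by rewrite eq_sym.
  by rewrite eq_sym symH.
rewrite /extend; under eq_bigr do rewrite mulr_sumr.
under [RHS]eq_bigr do rewrite mulr_sumr.
rewrite exchange_big; apply: eq_bigr => x _; apply: eq_bigr => y _.
by rewrite symQ mulrCA.
Qed.

Lemma laplacian_extend_green w x (f := fun x => extend (Q x) w) :
  #|G1|%:R * f x - \sum_y f y - (\sum_(y | adj x y) (f x - f y)) / 2 =
  weight w x - #|G1|%:R^-1.
Proof.
have -> : \sum_y f y = #|G1|%:R^-1.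
  rewrite -[RHS](extend_const _ w) /f /extend exchange_big.
  apply: eq_bigr => z _; rewrite -mulr_sumr; congr (_ * _); rewrite -(sumQ z).
  by apply: eq_bigr => y _; rewrite symQ.
rewrite -(extend_delta x w) addrAC; congr (_ - _).
have -> : \sum_(y | adj x y) (f x - f y)
        = \sum_z weight w z * (\sum_(y | adj x y) (Q x z - Q y z)).
  under [RHS]eq_bigr do rewrite mulr_sumr.
  rewrite exchange_big; apply: eq_bigr => y _ /=.
  by rewrite /f /extend -sumrB; apply: eq_bigr => z _; rewrite mulrBr.
rewrite /f /extend mulr_sumr mulr_suml -sumrB; apply: eq_bigr => z _.
by rewrite lapQ [z == x]eq_sym; field.
Qed.

(** The term left on [G1] is the one that the Schur complement of the extended
    part produces, so that it cancels in [laplacian_corona_green]. *)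
Lemma laplacian_local_green u w :
  \sum_(v | adj u v) (local_green u w - local_green v w) =
  (u == w)%:R - (if u is inl (inl x) then weight w x else 0).
Proof.
rewrite sum_corona; case: u => [[x|e]|[i x]] /=.
- rewrite big1 ?add0r => [|y _]; last by rewrite oppr0.
  rewrite [X in _ + X](eq_bigl (fun p : G1 * G2 => (x == p.1) && true)).
    2: by move=> p; rewrite andbT.
  rewrite (sum_fibre x xpredT) !sumrB.
  case: w => [[y|f]|[j z]] /=.
  + by rewrite !big1_eq !subr0 addr0; apply/esym/subrr.
  + rewrite !big1_eq !sub0r subr0; congr (- _).
    case: (boolP (x \in val f)) => xf.
      rewrite (bigD1 f) //= eqxx big1 ?addr0 // => e /andP[_ /negbTE->].
      by rewrite mul0r.
    rewrite big1 ?mul0r // => e xe.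
    by rewrite (_ : e == f = false) ?mul0r //; apply: contraNF xf => /eqP<-.
  rewrite !big1_eq subr0 !sub0r; congr (- _).
  rewrite -mulr_sumr; under eq_bigr do rewrite symH.
  by rewrite sumH mulr1.
- rewrite [X in _ + X + _]big_pred0 // [X in _ + X]big_pred0 // !addr0 !subr0.
  rewrite sumr_const card_edge; case: w => [[y|f]|[j z]] /=; rewrite ?mul0rn //.
  by rewrite -[_ / 2 *+ 2]mulr_natr mulfVK // pnatr_eq0.
rewrite [X in _ + X + _]big_pred0 // addr0 subr0.
rewrite (sum_fibre i (adj x)) (big_pred1 i) => [|y]; last by [].
rewrite subr0; case: w => [[y|f]|[j z]] /=; rewrite ?subrr ?big1_eq ?add0r //.
under eq_bigr do rewrite -mulrBr.
rewrite -mulr_sumr lapH -mulrDr addrC subrK.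
rewrite -[RHS]/(((i == j) && (x == z))%:R).
by rewrite -natrM mulnb.
Qed.

(** [L X = I - c 1^T], where [c] is [1 / n1] on [G1] and 0 elsewhere. *)
Lemma laplacian_corona_green u w :
  \sum_(v | adj u v) (corona_green u w - corona_green v w) =
  (u == w)%:R - (if u is inl (inl x) then #|G1|%:R^-1 else 0).
Proof.
transitivity (\sum_(v | adj u v) (extend (fun x => extend (Q x) w) u
                                 - extend (fun x => extend (Q x) w) v)
            + \sum_(v | adj u v) (local_green u w - local_green v w)).
  by rewrite -big_split; apply: eq_bigr => v _; rewrite /corona_green /=; ring.
rewrite laplacian_extend laplacian_local_green.
case: u => [[x|e]|p]; rewrite ?add0r //.
by rewrite laplacian_extend_green; ring.
Qed.

(** * Trace and total sum of the generalized inverse *)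

Variable r : nat.
Hypothesis reg1 : regular r G1.

Lemma sum_pairs (F : G1 -> G2 -> R) :
  \sum_(p : G1 * G2) F p.1 p.2 = \sum_x \sum_y F x y.
Proof. by rewrite pair_bigA. Qed.

Lemma sum_extend f : \sum_u extend f u = (1 + r%:R / 2 + #|G2|%:R) * \sum_x f x.
Proof.
rewrite sum_corona !mulrDl mul1r; congr (_ + _ + _).
- by apply: eq_bigr => x _; rewrite extend_old.
- under eq_bigr do rewrite extend_edge.
  rewrite -mulr_suml sum_edge_ends mulrAC mulr_sumr; congr (_ / 2).
  by apply: eq_bigr => x _; rewrite reg1.
under eq_bigr do rewrite extend_copy.
rewrite (sum_pairs (fun x _ => f x)) mulr_sumr; apply: eq_bigr => x _.
by rewrite sum_const.
Qed.

Lemma sum_local_green :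
  \sum_u \sum_w local_green u w = #|edges G1|%:R / 2 + #|G1|%:R * #|G2|%:R.
Proof.
rewrite sum_corona big1 ?add0r => [|x _]; last by rewrite big1 // => -[[?|?]|?].
congr (_ + _).
  rewrite -(card_edge_type G1) mulr_natl -sumr_const; apply: eq_bigr => e _.
  rewrite sum_corona [X in X + _ + _]big1 // [X in _ + X]big1 // addr0 add0r.
  rewrite (bigD1 e) //= eqxx mul1r big1 ?addr0 // => f.
  by rewrite eq_sym => /negbTE->; rewrite mul0r.
transitivity (\sum_(p : G1 * G2) 1 : R); last first.
  by rewrite sum_const card_prod mulr1 natrM.
apply: eq_bigr => -[i x] _.
rewrite sum_corona [X in X + _ + _]big1 // [X in _ + X + _]big1 // !add0r /=.
rewrite (sum_pairs (fun j y => (i == j)%:R * H x y)).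
under eq_bigr do rewrite -mulr_sumr sumH mulr1.
by rewrite (bigD1 i) //= eqxx big1 ?addr0 // => j; rewrite eq_sym => /negbTE->.
Qed.

Lemma sum_corona_green : (0 < #|G1|)%N ->
  \sum_u \sum_w corona_green u w =
  (1 + r%:R / 2 + #|G2|%:R) ^+ 2 + #|edges G1|%:R / 2 + #|G1|%:R * #|G2|%:R.
Proof.
move=> G1_gt0; rewrite -addrA -sum_local_green.
under eq_bigr do rewrite big_split.
rewrite big_split /=; congr (_ + _); rewrite exchange_big /=.
under eq_bigr do rewrite sum_extend.
rewrite -mulr_sumr exchange_big /=.
under eq_bigr do rewrite sum_extend sumQ.
rewrite -mulr_sumr sum_const mulfV ?mulr1 ?expr2 //.
by rewrite pnatr_eq0 -lt0n.
Qed.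

(** This is [tr (B^T Q B)] for the incidence matrix [B]; it reduces to [tr Q]
    because [B B^T = r I + A(G1) = 2 M - 2 (n1 - r) I] with [M Q = I]. *)
Lemma sum_edge_green :
  \sum_(e : E) \sum_(x in val e) \sum_(y in val e) Q x y =
  2 * (r%:R - #|G1|%:R) * (\sum_x Q x x) + 2 * #|G1|%:R.
Proof.
rewrite sum_edge_vertex mulr_sumr -[in 2 * #|G1|%:R]sum1_card.
rewrite natr_sum mulr_sumr.
rewrite -big_split; apply: eq_bigr => x _ /=.
rewrite (sum_incident x (fun e : {set G1} => \sum_(y in e) Q x y)).
have eqQ := lapQ x x; rewrite sumrB sum_adj_const reg1 eqxx in eqQ.
transitivity (\sum_(y | adj x y) Q x x + \sum_(y | adj x y) Q y x).
  rewrite -big_split; apply: eq_bigr => y xy; rewrite big_setU1 ?inE /=.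
    by rewrite big_set1 (symQ x y).
  by apply: contraTneq xy => ->; rewrite adj_irrefl.
rewrite sum_adj_const reg1.
move/(canRL (subKr _)): eqQ => ->.
by rewrite mulr1n; ring.
Qed.

Lemma trace_corona_green :
  \sum_u corona_green u u =
  (1 + #|G2|%:R + (r%:R - #|G1|%:R) / 2) * (\sum_x Q x x)
  + #|G1|%:R * (\sum_y H y y) + (#|G1|%:R + #|edges G1|%:R) / 2.
Proof.
rewrite sum_corona.
have -> : \sum_x corona_green (old_vertex x) (old_vertex x) = \sum_x Q x x.
  by apply: eq_bigr => x _; rewrite /corona_green !extend_old addr0.
have -> : \sum_e corona_green (edge_vertex e) (edge_vertex e) =
    (\sum_(e : E) \sum_(x in val e) \sum_(y in val e) Q x y) / 4
    + #|edges G1|%:R / 2.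
  rewrite -(card_edge_type G1) mulr_suml mulr_natl -sumr_const -big_split.
  apply: eq_bigr => e _ /=; rewrite /corona_green /= eqxx mul1r; congr (_ + _).
  rewrite extend_edge (eq_bigr (fun x => (\sum_(y in val e) Q x y) / 2)).
    2: by move=> x _; apply: extend_edge.
  by rewrite -mulr_suml; field.
have -> : \sum_p corona_green (copy_vertex p) (copy_vertex p) =
    #|G2|%:R * (\sum_x Q x x) + #|G1|%:R * \sum_y H y y.
  under eq_bigr do rewrite /corona_green !extend_copy /= eqxx mul1r.
  rewrite (sum_pairs (fun x y => Q x x + H y y)).
  under eq_bigr do rewrite big_split /= sum_const.
  by rewrite big_split /= sum_const -mulr_sumr.
by rewrite sum_edge_green; field.
Qed.

End CoronaGreen.

Theorem corollary3p9 (R : rcfType) (G1 G2 : sgraph) (r1 n1 m1 n2 : nat)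
    (conn1 : connected_graph G1) (conn2 : connected_graph G2)
    (reg1 : regular r1 G1)
    (hn1 : #|G1| = n1) (hm1 : #|edges G1| = m1) (hn2 : #|G2| = n2) :
  kirchhoff_index R (central_vertex_corona G1 G2) =
  (n1%:R + m1%:R + n1%:R * n2%:R) *
  ((m1%:R - n1%:R) / 2
   + (n2%:R + r1%:R + 3) / (r1%:R + 2 * n2%:R + 2)
   + \sum_(2 <= j < n2.+1) n1%:R / (1 + lap_eigenvalue R G2 j)
   + \sum_(2 <= i < n1.+1)
       (2 * n2%:R + 3 * n1%:R + 2 * adj_eigenvalue R G1 i + 2 - r1%:R)
       / (2 * n1%:R - r1%:R + adj_eigenvalue R G1 i)).
Proof.
case: conn1 conn2 => G1_gt0 _ [G2_gt0 _].
have r_lt : (r1 < #|G1|)%N.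
  by have /card_gt0P[x _] := G1_gt0; rewrite -(reg1 x) degree_lt_card.
have n1_neq0 : #|G1|%:R != 0 :> R by rewrite pnatr_eq0 -lt0n.
(* [n1 I + (A(G1) - r1 I) / 2 = (c I + A(G1)) / 2], so [Q = 2 Q0] below with
   [Q0] the inverse of [c I + A(G1)]. *)
pose c : R := 2 * #|G1|%:R - r1%:R.
have c_r : c + r1%:R = 2 * #|G1|%:R by rewrite /c subrK.
have eigA a : eigenvalue (adjacency_mx R G1) a -> 0 < c + a.
  move=> /(adj_eigenvalue_le reg1); rewrite ler_norml => /andP[ge_a _].
  have : r1%:R < #|G1|%:R :> R by rewrite ltr_nat.
  by rewrite /c; lra.
have [Q0 [symQ0 eqQ0 trQ0]] : exists Q0 : G1 -> G1 -> R,
    [/\ forall x y, Q0 x y = Q0 y x,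
    forall x z,
      c * Q0 x z + \sum_y adjacency_kernel R x y * Q0 y z = (x == z)%:R
  & \sum_x Q0 x x = \sum_(a <- eigenvalues (adjacency_mx R G1)) (c + a)^-1].
  rewrite adjacency_mxE; apply: kernel_green; first exact: adjacency_kernel_sym.
  by rewrite -adjacency_mxE => a /eigA; rewrite lt0r => /andP[].
have [H [symH eqH trH]] : exists H : G2 -> G2 -> R,
    [/\ forall x y, H x y = H y x,
    forall x z, 1 * H x z + \sum_y laplacian_kernel R x y * H y z = (x == z)%:R
  & \sum_x H x x = \sum_(a <- eigenvalues (laplacian_mx R G2)) (1 + a)^-1].
  rewrite laplacian_mxE; apply: kernel_green; first exact: laplacian_kernel_sym.
  rewrite -laplacian_mxE => a /lap_eigenvalue_ge0 a_ge0.
  by rewrite gt_eqF // ltr_pwDl.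
have sumQ0 x : 2 * #|G1|%:R * \sum_z Q0 x z = 1.
  rewrite -c_r; apply: (green_rowsum (adjacency_kernel_sym R (G := G1))) => // y.
  by rewrite adjacency_rowsum reg1.
have sumH x : \sum_z H x z = 1.
  rewrite -[RHS](green_rowsum (laplacian_kernel_sym R (G := G2)) symH eqH
                   (@laplacian_rowsum R G2) x).
  by rewrite addr0 mul1r.
pose Q x y := 2 * Q0 x y.
have symQ x y : Q x y = Q y x by rewrite /Q symQ0.
have lapQ x z :
    \sum_(y | adj x y) (Q x z - Q y z) = 2 * (#|G1|%:R * Q x z - (x == z)%:R).
  rewrite -eqQ0 -adj_sumE sumrB sum_adj_const reg1 /Q -mulr_sumr /c; ring.
have lapH x z : \sum_(y | adj x y) (H x z - H y z) = (x == z)%:R - H x z.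
  by rewrite -eqH -laplacian_kernelE; ring.
have sumQ x : \sum_y Q x y = #|G1|%:R^-1.
  by apply: (mulfI n1_neq0); rewrite mulfV // -mulr_sumr mulrCA mulrA sumQ0.
rewrite (kirchhoff_index_ginv (corona_green_sym symQ symH)
           (laplacian_corona_green symQ symH lapQ lapH sumQ sumH)).
rewrite (trace_corona_green H symQ lapQ reg1).
rewrite (sum_corona_green sumQ sumH reg1 G1_gt0).
have cardC : #|central_vertex_corona G1 G2|
    = (#|G1| + #|edges G1| + #|G1| * #|G2|)%N.
  by rewrite card_sum card_sum card_prod card_edge_type.
rewrite {}cardC !natrD natrM.
have hs : #|G1|%:R * r1%:R = 2 * #|edges G1|%:R :> R.
  by rewrite -handshake -sum_const; apply: eq_bigr => x _; rewrite reg1.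
pose F a : R := (2 * #|G2|%:R + 3 * #|G1|%:R + 2 * a + 2 - r1%:R) / (c + a).
have sumA : \sum_(2 <= i < #|G1|.+1) F (adj_eigenvalue R G1 i) =
    2 * #|G1|%:R + (2 * #|G2|%:R - #|G1|%:R + 2 + r1%:R) * \sum_x Q0 x x
    - F r1%:R.
  have symA : (adjacency_mx R G1)^T = adjacency_mx R G1.
    rewrite adjacency_mxE kernel_mx_sym // => x y.
    exact: adjacency_kernel_sym.
  rewrite (sum_adj_eigenvalue F G1_gt0 reg1) trQ0; congr (_ - _).
  have -> : 2 * #|G1|%:R = \sum_(a <- eigenvalues (adjacency_mx R G1)) 2 :> R.
    rewrite big_const_seq count_predT size_eigenvalues // iter_addr addr0.
    by rewrite mulr_natr.
  (* [F a = 2 + (2 n2 - n1 + 2 + r1) / (c + a)] *)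
  rewrite mulr_sumr -big_split; apply: eq_big_seq => a /=.
  rewrite eigenvalue_mem // => /eigA; rewrite /F /c => a_gt0.
  by field; rewrite gt_eqF.
have sumL : \sum_(2 <= j < #|G2|.+1) #|G1|%:R / (1 + lap_eigenvalue R G2 j) =
    #|G1|%:R * \sum_x H x x - #|G1|%:R.
  rewrite (sum_lap_eigenvalue (fun a => #|G1|%:R / (1 + a))) //.
  by rewrite addr0 divr1 trH mulr_sumr.
rewrite -hn1 -hm1 -hn2.
rewrite -[X in _ = _ * (_ + X)]/(
  \sum_(2 <= i < #|G1|.+1) F (adj_eigenvalue R G1 i)).
have -> : \sum_x Q x x = 2 * \sum_x Q0 x x by rewrite mulr_sumr.
rewrite sumA sumL /F c_r.
have -> : #|edges G1|%:R = #|G1|%:R * r1%:R / 2 :> R.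
  by rewrite hs mulrC mulKf // pnatr_eq0.
have den_neq0 : r1%:R + 2 * #|G2|%:R + 2 != 0 :> R.
  by rewrite -natrM -!natrD pnatr_eq0 addn2.
by field; rewrite n1_neq0.
Qed.
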